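(* Local density can be arbitrarily close to $1$: for every $\varepsilon>0$ there exist a finite tree $T$ and a nonempty proper subtree $S\subsetneq T$ with $D_T(S)>1-\varepsilon$.
   Context: A (nonempty) subtree of a tree $T$ is a nonempty connected subgraph; $|T|$ denotes the number of vertices of $T$. For a subtree $S\subseteq T$, let $N_T(S)$ be the number of subtrees of $T$ containing $S$ and $R_T(S)$ the sum of the orders (numbers of vertices) of all subtrees of $T$ containing $S$. The local mean at $S$ is $\mu_T(S)=R_T(S)/N_T(S)$. For a proper subtree $S\subsetneq T$ with $|T|=n$ and $|S|=k$, the local density at $S$ is $D_T(S)=\dfrac{\mu_T(S)-k}{n-k}$. *)

(* Defs.v *)
From mathcomp Require Import all_boot all_order all_algebra.
From mathcomp Require Import reals.

Set Implicit Arguments.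
Unset Strict Implicit.
Unset Printing Implicit Defensive.

Import Order.TTheory GRing.Theory Num.Theory.

(* A graph is given by its adjacency relation on a finite vertex type. *)

Definition simple_graph (V : finType) (e : rel V) : Prop :=
  symmetric e /\ irreflexive e.

(* Cycles have length at least 3: [ucycle e [:: x; y]] holds for any edge xy. *)
Definition acyclic (V : finType) (e : rel V) : Prop :=
  forall c : seq V, 2 < size c -> ~ ucycle e c.

Definition is_tree (V : finType) (e : rel V) : Prop :=
  [/\ simple_graph e, 0 < #|V|, forall x y : V, connect e x y & acyclic e].

Definition edges (V : finType) (e : rel V) : {set {set V}} :=
  [set [set p.1; p.2] | p : V * V & e p.1 p.2].

(* A pair (vertex set, edge set). *)
Definition graph_pair (V : finType) : finType :=
  ({set V} * {set {set V}})%type.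

Definition whole (V : finType) (e : rel V) : graph_pair V :=
  ([set: V], edges e).

Definition contained (V : finType) (X Y : graph_pair V) : bool :=
  (X.1 \subset Y.1) && (X.2 \subset Y.2).

Definition gorder (V : finType) (X : graph_pair V) : nat := #|X.1|.

(* [cover X.2 \subset X.1]: the endpoints of the edges of X are vertices of X. *)
Definition subgraph (V : finType) (e : rel V) (X : graph_pair V) : bool :=
  contained X (whole e) && (cover X.2 \subset X.1).

Definition adj (V : finType) (X : graph_pair V) : rel V :=
  [rel u v | [set u; v] \in X.2].

Definition connected (V : finType) (X : graph_pair V) : bool :=
  [forall x in X.1, forall y in X.1, connect (adj X) x y].

Definition subtree (V : finType) (e : rel V) (X : graph_pair V) : bool :=
  [&& subgraph e X, X.1 != set0 & connected X].

Definition proper_subtree (V : finType) (e : rel V) (X : graph_pair V) : bool :=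
  subtree e X && (X != whole e).

Definition subtrees_containing (V : finType) (e : rel V) (S : graph_pair V) :
    {set graph_pair V} :=
  [set X | subtree e X & contained S X].

Definition N_ (V : finType) (e : rel V) (S : graph_pair V) : nat :=
  #|subtrees_containing e S|.

Definition R_ (V : finType) (e : rel V) (S : graph_pair V) : nat :=
  \sum_(X in subtrees_containing e S) gorder X.

Local Open Scope ring_scope.

Definition local_mean (R : realType) (V : finType) (e : rel V)
    (S : graph_pair V) : R :=
  (R_ e S)%:R / (N_ e S)%:R.

Definition local_density (R : realType) (V : finType) (e : rel V)
    (S : graph_pair V) : R :=
  (local_mean R e S - (gorder S)%:R) / ((gorder (whole e))%:R - (gorder S)%:R).

(* Main.v *)
Require Import Defs.
From mathcomp Require Import all_boot all_order all_algebra.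
From mathcomp Require Import reals.
From mathcomp Require Import zify lra.

Set Implicit Arguments.
Unset Strict Implicit.
Unset Printing Implicit Defensive.

Import Order.TTheory GRing.Theory Num.Theory.

(** The witness is a broom: a path (the handle) with m + 1 vertices, with s
    leaves attached to one of its ends (the center); S is the single vertex at
    the other end. A subtree containing S is an initial segment of the handle
    when it misses the center, so there are at most m + 1 of those; when it
    contains the center it contains the whole handle, and any of the 2 ^ s sets
    of leaves may be added to it. Hence if 2 ^ s is at least (m + 1) ^ 2, almost
    every subtree containing S has more than m vertices, and the local mean is
    at least m. The tree has m + s + 1 vertices, so the density is at least
    1 - (s + 1) / (m + s) ([broom_density]), which tends to 1 when m also
    dominates s: take m = t ^ 2 and s = 4 t.

    To count subtrees, the broom is described by a parent function p on the
    ordinals, with p i < i away from the root 0. For every such function the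
    subtrees containing the root correspond to the vertex sets that contain the
    root and are closed under p ([subtrees_containing_root]): the counting
    becomes one of vertex sets, with no connectivity or edges left in it. *)

(** * Trees given by a parent function *)

Lemma set2_inj (T : finType) (u v i j : T) :
  [set u; v] = [set i; j] -> u = i /\ v = j \/ u = j /\ v = i.
Proof.
move=> E; have : u \in [set i; j] by rewrite -E set21.
have : v \in [set i; j] by rewrite -E set22.
have : i \in [set u; v] by rewrite E set21.
have : j \in [set u; v] by rewrite E set22.
by do 4!case/set2P => ?; subst; auto.
Qed.

Section ParentTree.

Variables (n : nat) (p : 'I_n.+1 -> 'I_n.+1).
Hypothesis p_root : p ord0 = ord0.
Hypothesis p_lt : forall i, i != ord0 -> p i < i.

Definition parent_rel : rel 'I_n.+1 :=
  fun x y => (x != y) && ((p x == y) || (p y == x)).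

Definition root_graph : graph_pair 'I_n.+1 := ([set ord0], set0).

Definition parent_edges (A : {set 'I_n.+1}) : {set {set 'I_n.+1}} :=
  [set [set i; p i] | i in A :\ ord0].

Definition rooted_sets : {set {set 'I_n.+1}} :=
  [set A : {set 'I_n.+1} | (ord0 \in A) && [forall i in A, p i \in A]].

Lemma p_neq i : i != ord0 -> p i != i.
Proof. by move/p_lt; rewrite ltn_neqAle => /andP[]. Qed.

Lemma parent_rel_sym : symmetric parent_rel.
Proof. by move=> x y; rewrite /parent_rel eq_sym orbC. Qed.

Lemma parent_relP i : i != ord0 -> parent_rel i (p i).
Proof. by move=> i0; rewrite /parent_rel eqxx eq_sym p_neq. Qed.

(** The only smaller neighbour of a vertex is its parent; this is what rules out
    cycles. *)
Lemma parent_of_lt x y : parent_rel x y -> x < y -> x = p y.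
Proof.
move=> /andP[xy /orP[/eqP pxy|/eqP //]] lt_xy.
have [x0|/p_lt] := eqVneq x ord0; last by rewrite pxy ltnNge ltnW.
by move: xy; rewrite -pxy x0 p_root eqxx.
Qed.

(** Stated for any relation [e], to serve both for the whole tree and for the
    adjacency relation of a subgraph. *)
Lemma connect_root (e : rel 'I_n.+1) (A : {set 'I_n.+1}) :
    (forall i, i \in A -> i != ord0 -> e i (p i) /\ p i \in A) ->
  forall i, i \in A -> connect e i ord0.
Proof.
move=> step i; have [k] := ubnP (i : nat); elim: k i => // k IH i lt_ik iA.
have [->|i0] := eqVneq i ord0; first exact: connect0.
have [ei piA] := step i iA i0.
apply: connect_trans (connect1 ei) (IH _ _ piA).
exact: leq_trans (p_lt i0) lt_ik.
Qed.

Lemma connect_all (e : rel 'I_n.+1) (A : {set 'I_n.+1}) : symmetric e ->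
    (forall i, i \in A -> i != ord0 -> e i (p i) /\ p i \in A) ->
  forall x y, x \in A -> y \in A -> connect e x y.
Proof.
move=> se step x y xA yA; apply: connect_trans (connect_root step xA) _.
by rewrite (sym_connect_sym se); exact: connect_root yA.
Qed.

(** Both neighbours of the largest vertex of a cycle are smaller than it, hence
    both are its parent, whereas in a cycle of length at least 3 they differ. *)
Lemma parent_rel_acyclic : acyclic parent_rel.
Proof.
move=> c c2 /andP[cyc unc].
have [x0 x0c] : exists x, x \in c by case: c c2 {cyc unc} => // a; exists a; rewrite mem_head.
case: (@arg_maxnP _ x0 (mem c) (fun i => nat_of_ord i) x0c) => y yc ymax.
have nb z : z \in c -> parent_rel y z -> z = p y.
  move=> zc eyz; apply: parent_of_lt; first by rewrite parent_rel_sym.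
  rewrite ltn_neqAle; apply/andP; split; last exact: (ymax z zc).
  by case/andP: eyz => + _; apply: contra => /eqP/val_inj->.
have nxt : next c y = p y by apply: nb; [rewrite mem_next | exact: next_cycle cyc yc].
have prv : prev c y = p y.
  by apply: nb; [rewrite mem_prev | rewrite parent_rel_sym; exact: prev_cycle cyc yc].
have : next c (next c y) = y by rewrite nxt -prv; exact: (next_prev unc).
case: (rot_to yc) => k c' rc.
have nextE z : next c z = next (y :: c') z by rewrite -rc next_rot.
rewrite !{}nextE.
have := c2; have := unc; rewrite -(size_rot k) -(rot_uniq k) rc.
case: c' {rc} => [|a [|b c']] //= /andP[]; rewrite !inE !negb_or eqxx.
move=> /and3P[ya yb _] _ _; rewrite [a == y]eq_sym (negbTE ya) eqxx => /eqP.
by rewrite eq_sym (negbTE yb).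
Qed.

Lemma parent_rel_tree : is_tree parent_rel.
Proof.
split.
- by split; [exact: parent_rel_sym | move=> x; rewrite /parent_rel eqxx].
- by rewrite card_ord.
- move=> x y; apply: (@connect_all _ [set: 'I_n.+1]) => //; first exact: parent_rel_sym.
  by move=> i _ i0; split; [exact: parent_relP | rewrite inE].
- exact: parent_rel_acyclic.
Qed.

(** Each edge joins exactly one non-root vertex to its parent. *)
Lemma edges_parent_rel : edges parent_rel = parent_edges setT.
Proof.
apply/setP=> E; apply/imsetP/imsetP => [[[x y]]|[i]].
- rewrite inE => /= /andP[xy /orP[] /eqP pE] ->.
  + exists x; last by rewrite pE.
    by rewrite !inE andbT; apply: contra xy => /eqP x0; rewrite -pE x0 p_root.
  + exists y; last by rewrite pE setUC.
    by rewrite !inE andbT; apply: contra xy => /eqP y0; rewrite -pE y0 p_root.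
- rewrite !inE andbT => i0 ->; exists (i, p i) => //.
  by rewrite inE; exact: parent_relP.
Qed.

Lemma fconnect_root i : fconnect p ord0 i -> i = ord0.
Proof. by move/iter_findex <-; rewrite iter_fix. Qed.

Lemma fconnect_parent k i : k != i -> fconnect p k i -> fconnect p (p k) i.
Proof.
move=> ki /connectP[[|y s] /= ]; first by move=> _ ik; rewrite ik eqxx in ki.
by move=> /andP[/eqP <- pth] ->; apply/connectP; exists s.
Qed.

Lemma adj_sym (V : finType) (X : graph_pair V) : symmetric (adj X).
Proof. by move=> x y; rewrite /adj/= setUC. Qed.

Section Subtree.

Variable X : graph_pair 'I_n.+1.
Hypotheses (Xsub : subtree parent_rel X) (rootX : ord0 \in X.1).

Lemma subtree_edge E : E \in X.2 -> exists2 i, i != ord0 & E = [set i; p i].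
Proof.
case/and3P: Xsub => /andP[/andP[_ /subsetP sE] _] _ _ /sE.
by rewrite /= edges_parent_rel => /imsetP[i]; rewrite !inE andbT; exists i.
Qed.

(** Without the edge from [i] to its parent, no edge of the subtree leaves the set
    of descendants of [i] (the vertices from which iterating [p] reaches [i]),
    so [i] cannot be connected to the root, which is not a descendant of [i]. *)
Lemma subtree_parent_edge i : i \in X.1 -> i != ord0 -> [set i; p i] \in X.2.
Proof.
move=> iX i0; apply/idPn => noti.
have cl : fingraph.closed (adj X) [pred j | fconnect p j i].
  apply: intro_closed; first exact/sym_connect_sym/adj_sym.
  move=> u v uv; have [k k0 /set2_inj [[uk vk]|[uk vk]]] := subtree_edge uv.
    rewrite !inE uk vk; apply: fconnect_parent.
    by apply: contra noti => /eqP <-; rewrite -vk -uk.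
  by rewrite !inE uk vk; apply: connect_trans; exact: fconnect1.
have con : connect (adj X) i ord0.
  by case/and3P: Xsub => _ _ /forall_inP/(_ _ iX)/forall_inP/(_ _ rootX).
have := closed_connect cl con; rewrite !inE connect0 => /esym/fconnect_root E.
by rewrite E eqxx in i0.
Qed.

Lemma subtree_edge_mem i : [set i; p i] \in X.2 -> (i \in X.1) && (p i \in X.1).
Proof.
case/and3P: Xsub => /andP[_ /subsetP sV] _ _ iE.
by rewrite !sV //; apply/bigcupP; exists [set i; p i]; rewrite // !inE eqxx ?orbT.
Qed.

Lemma subtree_rooted : X.1 \in rooted_sets.
Proof.
rewrite inE rootX; apply/forall_inP => i iX.
have [->|i0] := eqVneq i ord0; first by rewrite p_root.
by have /andP[] := subtree_edge_mem (subtree_parent_edge iX i0).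
Qed.

Lemma subtree_edges : X.2 = parent_edges X.1.
Proof.
apply/setP=> E; apply/idP/imsetP => [EX|[i /setD1P[i0 iX] ->]].
  have [i i0 Ei] := subtree_edge EX; exists i => //.
  by rewrite !inE i0; rewrite Ei in EX; case/andP: (subtree_edge_mem EX).
exact: subtree_parent_edge.
Qed.

End Subtree.

Lemma rooted_subtree A : A \in rooted_sets -> subtree parent_rel (A, parent_edges A).
Proof.
rewrite inE => /andP[rA /forall_inP pA]; apply/and3P; split.
- rewrite /subgraph /contained /= subsetT edges_parent_rel imsetS ?setSD //=.
  apply/bigcupsP => _ /imsetP[i /setD1P[_ iA] ->].
  by apply/subsetP => j /set2P[] ->; rewrite ?pA.
- by apply/set0Pn; exists ord0.
- apply/forall_inP => x xA; apply/forall_inP => y yA.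
  apply: connect_all xA yA; first exact: adj_sym.
  by move=> i iA i0; split; [apply: imset_f; rewrite !inE i0 | exact: pA].
Qed.

(** A subtree containing the root is determined by its vertex set, since it has
    exactly the parent edges of its non-root vertices. *)
Lemma subtrees_containing_root :
  subtrees_containing parent_rel root_graph =
    [set (A, parent_edges A) | A in rooted_sets].
Proof.
apply/setP=> X; rewrite inE /contained sub1set sub0set andbT.
apply/andP/imsetP => [[Xsub rX]|[A rA ->]].
  exists X.1; first exact: subtree_rooted.
  by rewrite -subtree_edges // -surjective_pairing.
by split; [exact: rooted_subtree | move: rA; rewrite inE => /andP[]].
Qed.

Lemma N_root : N_ parent_rel root_graph = #|rooted_sets|.
Proof. by rewrite /N_ subtrees_containing_root card_imset // => A B []. Qed.

Lemma R_root : R_ parent_rel root_graph = \sum_(A in rooted_sets) #|A|.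
Proof. by rewrite /R_ subtrees_containing_root big_imset //= => A B _ _ []. Qed.

Lemma root_graph_proper : 0 < n -> proper_subtree parent_rel root_graph.
Proof.
move=> n0; apply/andP; split; last first.
  apply/eqP => -[/(congr1 (fun A : {set _} => #|A|))].
  by rewrite cards1 cardsT card_ord => -[n_eq0]; rewrite -n_eq0 in n0.
have -> : root_graph = ([set ord0], parent_edges [set ord0]).
  by rewrite /parent_edges setDv imset0.
apply: rooted_subtree; rewrite !inE eqxx /=; apply/forall_inP => i /set1P ->.
by rewrite p_root inE.
Qed.

End ParentTree.

(** * Counting in the broom *)

Section Broom.

Variables m s : nat.

(** The vertices 0, ..., m form the handle, and every vertex beyond m is a leaf
    whose parent is m. *)
Definition broom_parent (i : 'I_(m + s).+1) : 'I_(m + s).+1 := inord (minn i.-1 m).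

Lemma broom_parentE i : broom_parent i = minn i.-1 m :> nat.
Proof. by rewrite inordK // ltnS (leq_trans (geq_minr _ _)) // leq_addr. Qed.

Lemma broom_parent_root : broom_parent ord0 = ord0.
Proof. by apply: val_inj; rewrite /= broom_parentE min0n. Qed.

Lemma broom_parent_lt i : i != ord0 -> broom_parent i < i.
Proof.
move=> i0; have : val i != 0 by apply: contra i0 => /eqP i0; apply/eqP/val_inj.
by rewrite broom_parentE /=; lia.
Qed.

Definition broom := parent_rel broom_parent.

Definition center : 'I_(m + s).+1 := inord m.
Definition handle : {set 'I_(m + s).+1} := [set i : 'I_(m + s).+1 | i <= m].

Lemma centerE : center = m :> nat.
Proof. by rewrite inordK // ltnS leq_addr. Qed.

Lemma card_handle : #|handle| = m.+1.
Proof.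
have le_m : m.+1 <= (m + s).+1 by lia.
have inj : injective (widen_ord le_m) by move=> i j /(congr1 val) /= /val_inj.
rewrite -[RHS]card_ord -cardsT -(card_imset _ inj).
apply: eq_card => i; rewrite !inE; apply/idP/imsetP => [im|[j _ ->]].
  by exists (Ordinal (im : i < m.+1)) => //; apply: val_inj.
by rewrite /= -ltnS.
Qed.

Lemma center_handle A :
  A \in rooted_sets broom_parent -> center \in A -> handle \subset A.
Proof.
rewrite inE => /andP[_ /forall_inP pA] cA; apply/subsetP => i; rewrite inE => im.
have [k] := ubnP (m - i); elim: k i im => // k IH i im lt_k.
have [/eqP Ei|ne] := boolP (i == center); first by rewrite Ei.
have lt_im : i < m.
  by rewrite ltn_neqAle im andbT; apply: contra ne => /eqP E; apply/eqP/val_inj; rewrite /= centerE.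
pose j : 'I_(m + s).+1 := inord i.+1.
have jE : j = i.+1 :> nat by rewrite inordK //; lia.
have -> : i = broom_parent j by apply: val_inj; rewrite /= broom_parentE jE /=; lia.
by apply/pA/IH; rewrite jE //; lia.
Qed.

(** Let [j] be the least vertex outside [A]; it is at most m. Every vertex beyond
    [j] has its parent at or beyond [j], so by induction none of them is in [A]. *)
Lemma no_center_prefix A :
    A \in rooted_sets broom_parent -> center \notin A ->
  exists j : 'I_m.+1, A = [set i : 'I_(m + s).+1 | i < j].
Proof.
rewrite inE => /andP[_ /forall_inP pA] cA.
case: (@arg_minnP _ center (fun i => i \notin A) (fun i => nat_of_ord i) cA) => j jA jmin.
have jm : j < m.+1 by have := jmin _ cA; rewrite centerE.
exists (Ordinal jm); apply/setP => i; rewrite inE /=.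
case: ltnP => [lt_ij|]; first by apply/idPn => /jmin; rewrite leqNgt lt_ij.
have [k] := ubnP (i : nat); elim: k i => // k IH i lt_ik le_ji.
have [<-|ne] := eqVneq j i; first exact: negbTE.
have ne' : val j != val i by apply: contra ne => /eqP/val_inj->.
apply/negP => /pA; rewrite IH // broom_parentE; move: ne' => /=; lia.
Qed.

Lemma card_no_center :
  #|[set A in rooted_sets broom_parent | center \notin A]| <= m.+1.
Proof.
rewrite -[leqRHS]card_ord -cardsT.
apply: leq_trans (leq_imset_card
  (fun j : 'I_m.+1 => [set i : 'I_(m + s).+1 | i < j]) [set: 'I_m.+1]).
apply/subset_leq_card/subsetP => A; rewrite inE => /andP[rA cA].
by have [j ->] := no_center_prefix rA cA; apply: imset_f.
Qed.

(** Adding any set of leaves to the handle gives a set closed under parents. *)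
Lemma card_center :
  2 ^ s <= #|[set A in rooted_sets broom_parent | center \in A]|.
Proof.
have card_leaves : #|~: handle| = s.
  by apply: (@addnI #|handle|); rewrite cardsC card_handle card_ord addSn.
rewrite -[in leqLHS]card_leaves -card_powerset -(@card_in_imset _ _ (fun A => handle :|: A)).
  apply/subset_leq_card/subsetP => _ /imsetP[A _ ->].
  rewrite !inE leq0n centerE leqnn /= andbT; apply/forall_inP => i _.
  by rewrite !inE broom_parentE geq_minr.
move=> A B; rewrite !inE => sA sB /(congr1 (fun D => D :\: handle)).
by rewrite !setDUl setDv !set0U !setDE !(setIidPl _).
Qed.

(** [L] is the number of subtrees containing both the root and the center. *)
Lemma broom_N_R : exists L,
  [/\ 2 ^ s <= L, 0 < N_ broom (root_graph _), N_ broom (root_graph _) <= m.+1 + L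
    & m.+1 * L <= R_ broom (root_graph _)].
Proof.
pose rs := rooted_sets broom_parent.
exists #|[set A in rs | center \in A]|.
have EN : N_ broom (root_graph _) =
    #|[set A in rs | center \notin A]| + #|[set A in rs | center \in A]|.
  rewrite N_root; [|exact: broom_parent_root|exact: broom_parent_lt].
  rewrite -(cardsID [set A : {set 'I_(m + s).+1} | center \in A]) addnC; congr (_ + _); apply: eq_card => A.
    by rewrite !inE andbC.
  by rewrite !inE.
split; first exact: card_center.
- by rewrite EN addn_gt0; apply/orP; right; apply: leq_trans card_center; rewrite expn_gt0.
- by rewrite EN leq_add2r card_no_center.
- rewrite R_root; [|exact: broom_parent_root|exact: broom_parent_lt].
  rewrite mulnC -sum_nat_const.
  rewrite [leqRHS](bigID (fun A : {set 'I_(m + s).+1} => center \in A)) /=.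
  apply: leq_trans (leq_addr _ _).
  under eq_bigl do rewrite inE.
  apply: leq_sum => A /andP[rA cA].
  by rewrite -card_handle; apply/subset_leq_card/center_handle.
Qed.

End Broom.

Arguments broom : clear implicits.

Local Open Scope ring_scope.

(** * The density estimate *)

(** With M = m + 1 and L as in [broom_N_R], the local mean is at least
    M L / (M + L), which is at least M - 1 = m as soon as M ^ 2 <= L. *)
Lemma broom_density (R : realType) (m s : nat) : (0 < m)%N -> (m.+1 ^ 2 <= 2 ^ s)%N ->
  1 - (s.+1)%:R / (m + s)%:R <= local_density R (broom m s) (root_graph _).
Proof.
move=> m0 le_ms; have [L [leL N0 leN leR]] := broom_N_R m s.
rewrite /local_density /local_mean /gorder cards1 cardsT card_ord.
set N := N_ _ _ in N0 leN *; set r := R_ _ _ in leR *.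
have ms0 : 0 < (m + s)%:R :> R by rewrite ltr0n addn_gt0 m0.
have -> : (m + s).+1%:R - 1%:R = (m + s)%:R :> R by rewrite -natrB // subn1.
rewrite ler_pdivlMr // mulrBl mul1r divfK ?gt_eqF //.
rewrite lerBrDr ler_pdivlMr ?ltr0n //.
have -> : (m + s)%:R - s.+1%:R + 1%:R = m%:R :> R.
  by rewrite natrD -addn1 (natrD _ s 1); lra.
rewrite -natrM ler_nat; apply: leq_trans leR.
have : (m.+1 ^ 2 <= L)%N by apply: leq_trans leL.
by nia.
Qed.

Theorem mainTheorem5 (R : realType) (eps : R) (heps : 0 < eps) :
  exists (V : finType) (e : rel V) (S : graph_pair V),
    [/\ is_tree e, proper_subtree e S & 1 - eps < local_density R e S].
Proof.
(* For m = t ^ 2 and s = 4 t, (s + 1) / (m + s) <= 4 / t. *)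
have [t t_gt] : exists t : nat, 4 / eps < t%:R.
  by exists (Num.bound (4 / eps)); apply: archi_boundP; rewrite divr_ge0 // ltW.
have t0 : 0 < t%:R :> R by apply: lt_trans t_gt; rewrite divr_gt0.
pose m := (t ^ 2)%N; pose s := (4 * t)%N.
have m0 : (0 < m)%N by rewrite expn_gt0 -(ltr0n R) t0.
(* t ^ 2 + 1 <= (t + 1) ^ 2 <= (2 ^ t) ^ 2, and squaring gives 2 ^ (4 t). *)
have le_ms : (m.+1 ^ 2 <= 2 ^ s)%N.
  have := ltn_expl t (ltnSn 1); rewrite /m /s mulnC expnM (expnM _ 2 2).
  set u := (2 ^ t)%N => lt_tu; rewrite leq_sqr; nia.
exists _, (broom m s), (root_graph _); split.
- by apply: parent_rel_tree; [exact: broom_parent_root | exact: broom_parent_lt].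
- apply: root_graph_proper; [exact: broom_parent_root | exact: broom_parent_lt |].
  by rewrite addn_gt0 m0.
apply: lt_le_trans (broom_density R m0 le_ms).
rewrite ltrD2l ltrN2 ltr_pdivrMr ?ltr0n ?addn_gt0 ?m0 //.
move: t_gt; rewrite ltr_pdivrMr // => t_gt.
rewrite -natr1 natrD natrX natrM.
have : 1 <= t%:R :> R by rewrite ler1n -(ltr0n R).
nra.
Qed.
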